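(* Let $(\mathfrak g,[\cdot,\cdot]_{\mathfrak g},s_{\mathfrak g})$ be a finite-dimensional Lie superalgebra over a field of characteristic $2$ with an even NIS $\mathscr B$. Let $r=\sum_i a_i\otimes b_i\in\mathfrak g\otimes\mathfrak g$ be symmetric and even, let $R:\mathfrak g^*\to\mathfrak g$ be $R(f)=\sum_i f(a_i)b_i$, let $\Phi:\mathfrak g\to\mathfrak g^*$ be $\Phi(x)=\mathscr B(x,\cdot)$, and put $U:=R\circ\Phi:\mathfrak g\to\mathfrak g$. Then: (i) $\langle f,R(h)\rangle=\langle h,R(f)\rangle$ for all $f,h\in\mathfrak g^*$ if and only if $U$ is $\mathscr B$-symmetric, i.e. $\mathscr B(U(x),y)=\mathscr B(x,U(y))$ for all $x,y\in\mathfrak g$. (ii) $\langle f,[R(h),R(l)]_{\mathfrak g}\rangle+\langle l,[R(f),R(h)]_{\mathfrak g}\rangle+\langle h,[R(l),R(f)]_{\mathfrak g}\rangle=0$ for all $f,h,l\in\mathfrak g^*$ if and only if $$U(\widetilde{[x,y]})=[U(x),U(y)]_{\mathfrak g}\quad\text{for all }x,y\in\mathfrak g.$$ (iii) The identity $$h\circ \mathrm{ad}_{s_{\mathfrak g}(R(f))}+f\circ \mathrm{ad}_{[R(h),R(f)]_{\mathfrak g}}+f\circ \mathrm{ad}_{R(h\circ \mathrm{ad}_{R(f)})+R(f\circ \mathrm{ad}_{R(h)})}+h\circ \mathrm{ad}_{R(f\circ \mathrm{ad}_{R(f)})}=0$$ holds for all $h\in\mathfrak g^*$ and $f\in\mathfrak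 g^*_{\bar 1}$ if and only if for all $x\in\mathfrak g_{\bar 1}$ and $y\in\mathfrak g$ $$\mathrm{ad}_y\bigl(U(\tilde s_{\mathfrak g}(x))+s_{\mathfrak g}(U(x))\bigr)=\mathrm{ad}_x\bigl(U(\widetilde{[x,y]})+[U(x),U(y)]_{\mathfrak g}\bigr).$$
   Context: A Lie superalgebra in characteristic $2$ is a superspace $\mathfrak g=\mathfrak g_{\bar 0}\oplus\mathfrak g_{\bar 1}$ such that $\mathfrak g_{\bar 0}$ is a Lie algebra, $\mathfrak g_{\bar 1}$ is a $\mathfrak g_{\bar 0}$-module made two-sided by symmetry, together with a squaring $s_{\mathfrak g}:\mathfrak g_{\bar 1}\to\mathfrak g_{\bar 0}$ with $s_{\mathfrak g}(\lambda x)=\lambda^2 s_{\mathfrak g}(x)$ such that $[x,y]_{\mathfrak g}:=s_{\mathfrak g}(x+y)-s_{\mathfrak g}(x)-s_{\mathfrak g}(y)$ is bilinear on $\mathfrak g_{\bar 1}$ (this is the bracket of odd elements), and $[s_{\mathfrak g}(x),y]_{\mathfrak g}=[x,[x,y]_{\mathfrak g}]_{\mathfrak g}$ for all $x\in\mathfrak g_{\bar 1}$, $y\in\mathfrak g$. A NIS is a non-degenerate bilinear form $\mathscr B$ which is invariant ($\mathscr B([x,y],z)=\mathscr B(x,[y,z])$), symmetric, and satisfies $\mathscr B(x,x)=0$ for odd $x$; it is even if $\mathscr B(\mathfrak g_{\bar 0},\mathfrak g_{\bar 1})=0$. $\langle f,x\rangle=f(x)$; $f\circ \mathrm{ad}_z\in\mathfrak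 g^*$ is $y\mapsto f([z,y]_{\mathfrak g})$; $\mathrm{ad}_x(y)=[x,y]_{\mathfrak g}$. $r$ is symmetric if invariant under the flip, even if $r\in(\mathfrak g\otimes\mathfrak g)_{\bar 0}$. On $\mathfrak g^*$ put $[f,h]_{\mathfrak g^*}:=h\circ \mathrm{ad}_{R(f)}+f\circ \mathrm{ad}_{R(h)}$ for $f,h\in\mathfrak g^*$ and $s_{\mathfrak g^*}(f):=f\circ \mathrm{ad}_{R(f)}$ for $f\in\mathfrak g^*_{\bar 1}$. Then $\widetilde{[x,y]}:=\Phi^{-1}([\Phi(x),\Phi(y)]_{\mathfrak g^*})$ for $x,y\in\mathfrak g$ and $\tilde s_{\mathfrak g}(x):=\Phi^{-1}(s_{\mathfrak g^*}(\Phi(x)))$ for $x\in\mathfrak g_{\bar 1}$. *)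

(* Defs.v *)
From HB Require Import structures.
From mathcomp Require Import all_boot all_algebra.
From mathcomp Require Import sesquilinear.

Set Implicit Arguments.
Unset Strict Implicit.
Unset Printing Implicit Defensive.

Import GRing.Theory.
Local Open Scope ring_scope.

(* The squaring is a total function, but it is constrained (and meaningful)
   only on the odd part. That [K] has characteristic 2 is not part of the
   record; it is meant to be assumed separately.                             *)
Record lieSuperalgebra2 (K : fieldType) := LieSuperalgebra2 {
  carrier :> vectType K;
  ev : {vspace carrier};
  od : {vspace carrier};
  br : {bilinear carrier -> carrier -> carrier};
  sq : carrier -> carrier;
  ev_od_full : (ev + od)%VS = fullv;
  ev_od_direct : (ev :&: od)%VS = 0%VS;
  br_ev : forall x y, x \in ev -> y \in ev -> br x y \in ev;
  br_alt : forall x, x \in ev -> br x x = 0;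
  br_jacobi : forall x y z, x \in ev -> y \in ev -> z \in ev ->
    br x (br y z) + br y (br z x) + br z (br x y) = 0;
  br_ev_od : forall x y, x \in ev -> y \in od -> br x y \in od;
  br_module : forall x y z, x \in ev -> y \in ev -> z \in od ->
    br (br x y) z = br x (br y z) - br y (br x z);
  br_two_sided : forall x y, x \in ev -> y \in od -> br y x = br x y;
  sq_ev : forall x, x \in od -> sq x \in ev;
  sqZ : forall (k : K) x, x \in od -> sq (k *: x) = k ^+ 2 *: sq x;
  br_od : forall x y, x \in od -> y \in od ->
    br x y = sq (x + y) - sq x - sq y;
  br_sq : forall x y, x \in od -> br (sq x) y = br x (br x y)
}.

Arguments sq {K} _ _.
Arguments br {K} _.
Arguments ev {K} _.
Arguments od {K} _.

Section Objects.
Variables (K : fieldType) (g : lieSuperalgebra2 K).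

Definition dual := 'Hom(g, K^o).

Definition dual_odd (f : dual) : bool := (ev g <= lker f)%VS.

Definition ad (x : g) : 'End(g) := linfun (br g x).

Lemma adE x y : ad x y = br g x y.
Proof. by rewrite /ad lfunE. Qed.

Record even_NIS (B : {bilinear g -> g -> K^o}) : Prop := EvenNIS {
  NIS_nondegenerate : forall x, (forall y, B x y = 0) -> x = 0;
  NIS_invariant : forall x y z, B (br g x y) z = B x (br g y z);
  NIS_symmetric : forall x y, B x y = B y x;
  NIS_odd_isotropic : forall x, x \in od g -> B x x = 0;
  NIS_even : forall x y, x \in ev g -> y \in od g -> B x y = 0
}.

(* [g (x) g], by coordinates in the product basis [e_i (x) e_j] of a basis
   of [g]; the flip [x (x) y |-> y (x) x] is then matrix transposition.      *)
Definition tensor_sq := 'M[K]_(\dim (fullv : {vspace g})).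

Definition tens (x y : g) : tensor_sq :=
  \matrix_(i, j) (coord (vbasis fullv) i x * coord (vbasis fullv) j y).

Definition flip (t : tensor_sq) : tensor_sq := t^T.

Lemma flip_tens x y : flip (tens x y) = tens y x.
Proof. by apply/matrixP=> i j; rewrite !mxE mulrC. Qed.

Definition tensv (X Y : {vspace g}) : {vspace tensor_sq} :=
  <<[seq tens x y | x <- vbasis X, y <- vbasis Y]>>%VS.

Definition tensor_ev : {vspace tensor_sq} :=
  (tensv (ev g) (ev g) + tensv (od g) (od g))%VS.

Definition Rmap n (a b : 'I_n -> g) (f : dual) : g :=
  \sum_(i < n) f (a i) *: b i.

Definition dual_br (R : dual -> g) (f h : dual) : dual :=
  ((h \o ad (R f)) + (f \o ad (R h)))%VF.

Definition dual_sq (R : dual -> g) (f : dual) : dual := (f \o ad (R f))%VF.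

Section WithForm.
Variable B : {bilinear g -> g -> K^o}.

Definition Phi : 'Hom(g, dual) := linfun (fun x : g => linfun (B x) : dual).

Lemma PhiE x y : Phi x y = B x y.
Proof.
have lin : linear (fun x : g => linfun (B x) : dual).
  move=> k u v; apply/lfunP=> z.
  by rewrite add_lfunE scale_lfunE !lfunE /= linearPl.
pose L := GRing.isLinear.Build K g dual *:%R _ lin.
pose F : {linear g -> dual} := HB.pack (fun x : g => linfun (B x) : dual) L.
by rewrite /Phi (lfunE F) lfunE.
Qed.

(* [Phi^-1] is the library's linear pseudo-inverse; it is the genuine
   two-sided inverse when [B] is non-degenerate.                             *)
Definition tilde_br (R : dual -> g) (x y : g) : g :=
  (Phi^-1)%VF (dual_br R (Phi x) (Phi y)).

Definition tilde_sq (R : dual -> g) (x : g) : g :=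
  (Phi^-1)%VF (dual_sq R (Phi x)).

Definition Umap (R : dual -> g) (x : g) : g := R (Phi x).

End WithForm.
End Objects.

(* Main.v *)
Require Import Defs.
From HB Require Import structures.
From mathcomp Require Import all_boot all_algebra.
From mathcomp Require Import sesquilinear.

Set Implicit Arguments.
Unset Strict Implicit.
Unset Printing Implicit Defensive.

Import GRing.Theory.
Local Open Scope ring_scope.

(** Everything follows by transporting the conditions from the dual to [g]
    along [Phi], which non-degeneracy and a dimension count make a linear
    bijection, and by reading them off in terms of the form.  Three facts
    drive the translation.

    - Invariance of [B] turns precomposition with [ad] into a bracket:
      [Phi z o ad w = Phi [z, w]] ([Phi_comp_ad]).  Hence the transported
      bracket is [[y, U x] + [x, U y]] and the transported squaring is
      [[x, U x]] ([tilde_brE], [tilde_sqE]).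
    - The bracket is symmetric in characteristic 2 ([br_sym]), so signs and
      the order of the arguments are immaterial.
    - Since [r] is symmetric, [f (R h) = h (R f)] ([Rmap_sym]); so both sides
      of (i) hold, and [U] is self-adjoint for [B].

    Put [V x y = U (tilde [x, y]) + [U x, U y]], which vanishes exactly when
    [U] respects the brackets at [x, y].  Self-adjointness and invariance
    rewrite [B (V x y) z] as the cyclic sum of (ii) at [Phi x], [Phi y],
    [Phi z], and non-degeneracy gives (ii).  For (iii), put
    [W x = U (tilde s x) + s (U x)]; at [f = Phi x] and [h = Phi z] the left
    side of the identity is [Phi ([z, W x] + [x, V x z])].  As [Phi] is
    injective, and matches odd vectors with odd functionals ([dual_odd_Phi]),
    (iii) follows. *)

Section Characteristic2.
Variables (K : fieldType) (char2 : 2%N \in [pchar K]).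

Lemma addvv_pchar2 (V : lmodType K) (x : V) : x + x = 0.
Proof. by rewrite -mulr2n -scaler_nat (pcharf0 char2) scale0r. Qed.

Lemma oppv_pchar2 (V : lmodType K) (x : V) : - x = x.
Proof. by apply/eqP; rewrite eq_sym -addr_eq0 addvv_pchar2. Qed.

Lemma addv_eq0_pchar2 (V : lmodType K) (x y : V) : x + y = 0 <-> x = y.
Proof.
split=> [/eqP | ->]; last exact: addvv_pchar2.
by rewrite addr_eq0 oppv_pchar2 => /eqP.
Qed.

Variable g : lieSuperalgebra2 K.

Lemma super_decomp (x : g) :
  exists x0 x1, [/\ x0 \in ev g, x1 \in od g & x = x0 + x1].
Proof.
have: x \in (ev g + od g)%VS by rewrite ev_od_full memvf.
by case/memv_addP=> x0 x0_ev [x1 x1_od ->]; exists x0, x1.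
Qed.

(** On the even part an alternating bracket is antisymmetric, which here means
    symmetric; on the odd part the polarization of the squaring is visibly
    symmetric; the mixed brackets are symmetric by definition. *)
Lemma br_sym (x y : g) : br g x y = br g y x.
Proof.
have ev_sym u v : u \in ev g -> v \in ev g -> br g u v = br g v u.
  move=> u_ev v_ev; apply/addv_eq0_pchar2.
  have := br_alt (rpredD u_ev v_ev).
  by rewrite !linearDl !linearDr !br_alt //= addr0 add0r.
have od_sym u v : u \in od g -> v \in od g -> br g u v = br g v u.
  by move=> u_od v_od; rewrite !br_od // [u + v]addrC addrAC.
have [x0 [x1 [x0_ev x1_od ->]]] := super_decomp x.
have [y0 [y1 [y0_ev y1_od ->]]] := super_decomp y.
rewrite !linearDl !linearDr /= (ev_sym x0 y0) // (od_sym x1 y1) //.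
rewrite (br_two_sided x0_ev y1_od) (br_two_sided y0_ev x1_od).
by rewrite addrACA.
Qed.

End Characteristic2.

Section Tensor.
Variables (K : fieldType) (g : lieSuperalgebra2 K).
Variables (n : nat) (a b : 'I_n -> g).

Lemma Rmap_additive (f h : dual g) : Rmap a b (f + h) = Rmap a b f + Rmap a b h.
Proof.
rewrite /Rmap -big_split /=; apply: eq_bigr => i _.
by rewrite add_lfunE scalerDl.
Qed.

Lemma dual_coord (f : dual g) (x : g) :
  f x = \sum_j coord (vbasis fullv) j x * f (vbasis (fullv : {vspace g}))`_j.
Proof.
rewrite [in LHS](coord_vbasis (memvf x)) linear_sum /=.
by apply: eq_bigr => j _; rewrite linearZ.
Qed.

(** The pairing [f (R h)] depends on the [a k] and [b k] only through the
    coordinates of the tensor they represent, so a symmetry of that tensor,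
    though not visible on the chosen decomposition, passes to the pairing. *)
Lemma dual_Rmap (f h : dual g) :
  let e := vbasis (fullv : {vspace g}) in
  f (Rmap a b h) =
  \sum_i \sum_j (\sum_k tens (a k) (b k)) i j * (h e`_i * f e`_j).
Proof.
move=> e; rewrite /Rmap linear_sum /=.
under eq_bigr => k _ do
  rewrite linearZ /= (dual_coord h (a k)) (dual_coord f (b k)) /=.
transitivity (\sum_k \sum_i \sum_j tens (a k) (b k) i j * (h e`_i * f e`_j)).
  apply: eq_bigr => k _; rewrite [LHS]mulr_suml; apply: eq_bigr => i _.
  rewrite mulr_sumr; apply: eq_bigr => j _; rewrite mxE; exact: mulrACA.
rewrite exchange_big; apply: eq_bigr => i _.
rewrite exchange_big; apply: eq_bigr => j _.
by rewrite summxE mulr_suml.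
Qed.

Lemma Rmap_sym (f h : dual g) :
  flip (\sum_k tens (a k) (b k)) = \sum_k tens (a k) (b k) ->
  f (Rmap a b h) = h (Rmap a b f).
Proof.
move=> r_sym; rewrite !dual_Rmap exchange_big.
apply: eq_bigr => i _; apply: eq_bigr => j _.
by rewrite -[in LHS]r_sym mxE [X in _ * X]mulrC.
Qed.

End Tensor.

Section Form.
Variables (K : fieldType) (g : lieSuperalgebra2 K).
Variables (B : {bilinear g -> g -> K^o}) (B_NIS : even_NIS B).

Lemma lker_Phi : lker (Phi B) == 0%VS.
Proof.
apply/lker0P=> x y Pxy; apply/eqP; rewrite -subr_eq0; apply/eqP.
apply: (NIS_nondegenerate B_NIS) => z.
by rewrite -PhiE linearB /= Pxy subrr lfunE.
Qed.

Lemma PhiK : cancel (Phi B) (Phi B)^-1%VF.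
Proof. exact: lker0_lfunK lker_Phi. Qed.

(** [Phi] is injective between spaces of equal dimension, hence onto. *)
Lemma PhiVK : cancel (Phi B)^-1%VF (Phi B).
Proof.
move=> f; apply: limg_lfunVK; suff ->: limg (Phi B) = fullv by exact: memvf.
apply/eqP; rewrite eqEdim subvf /= limg_dim_eq; last first.
  by rewrite (eqP lker_Phi) capv0.
by rewrite !dimvf /dim /= muln1.
Qed.

Lemma Phi_comp_ad (z w : g) : (Phi B z \o ad w)%VF = Phi B (br g z w).
Proof.
apply/lfunP=> y.
by rewrite comp_lfunE adE !PhiE (NIS_invariant B_NIS).
Qed.

(** The even and odd parts are orthogonal.  If [Phi x] kills the even part,
    then the even component of [x] is therefore orthogonal to everything, so
    it is zero. *)
Lemma dual_odd_Phi (x : g) : dual_odd (Phi B x) = (x \in od g).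
Proof.
apply/idP/idP=> [Px_odd | x_od]; last first.
  apply/subvP=> y y_ev; rewrite memv_ker PhiE (NIS_symmetric B_NIS).
  by rewrite (NIS_even B_NIS).
have [x0 [x1 [x0_ev x1_od def_x]]] := super_decomp x.
suff x0_0: x0 = 0 by rewrite def_x x0_0 add0r.
apply: (NIS_nondegenerate B_NIS) => y.
have [y0 [y1 [y0_ev y1_od ->]]] := super_decomp y.
rewrite linearDr /= (NIS_even B_NIS x0_ev y1_od) addr0.
have /subvP/(_ y0 y0_ev) := Px_odd.
rewrite memv_ker PhiE def_x linearDl /= => /eqP.
by rewrite (NIS_symmetric B_NIS x1) (NIS_even B_NIS y0_ev x1_od) addr0.
Qed.

Variable R : dual g -> g.

Lemma tilde_brE (x y : g) :
  tilde_br B R x y = br g y (Umap B R x) + br g x (Umap B R y).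
Proof. by rewrite /tilde_br /dual_br !Phi_comp_ad -linearD PhiK. Qed.

Lemma tilde_sqE (x : g) : tilde_sq B R x = br g x (Umap B R x).
Proof. by rewrite /tilde_sq /dual_sq Phi_comp_ad PhiK. Qed.

End Form.

Theorem proposition3p4p19
  (K : fieldType) (char2 : 2%N \in [pchar K])
  (g : lieSuperalgebra2 K)
  (B : {bilinear g -> g -> K^o}) (B_NIS : even_NIS B)
  (n : nat) (a b : 'I_n -> g) (r : tensor_sq g)
  (r_def : r = \sum_(i < n) tens (a i) (b i))
  (r_sym : flip r = r) (r_even : r \in tensor_ev g) :
  let R := Rmap a b in
  let U := Umap B R in
  [/\ (* (i) *)
      (forall f h : dual g, f (R h) = h (R f))
      <-> (forall x y : g, B (U x) y = B x (U y)),
      (* (ii) *)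
      (forall f h l : dual g,
         f (br g (R h) (R l)) + l (br g (R f) (R h)) + h (br g (R l) (R f)) = 0)
      <-> (forall x y : g, U (tilde_br B R x y) = br g (U x) (U y))
    & (* (iii) *)
      (forall h f : dual g, dual_odd f ->
         ((h \o ad (sq g (R f))) + (f \o ad (br g (R h) (R f)))
          + (f \o ad (R (h \o ad (R f)) + R (f \o ad (R h))))
          + (h \o ad (R (f \o ad (R f)))))%VF = 0)
      <-> (forall x y : g, x \in od g ->
         ad y (U (tilde_sq B R x) + sq g (U x))
         = ad x (U (tilde_br B R x y) + br g (U x) (U y)))].
Proof.
move=> R U.
have R_sym (f h : dual g) : f (R h) = h (R f).
  by apply: Rmap_sym; rewrite -r_def.
have RD : {morph R : f h / f + h} by apply: Rmap_additive.
have UD x y : U (x + y) = U x + U y by rewrite /U /Umap linearD RD.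
have U_sym x y : B (U x) y = B x (U y).
  by rewrite (NIS_symmetric B_NIS) -!PhiE; apply: R_sym.
(* The obstruction to [U] being a morphism from the transported bracket. *)
pose V x y := U (tilde_br B R x y) + br g (U x) (U y).
have V_sym x y : V x y = V y x.
  rewrite /V !(tilde_brE B_NIS) [X in U X]addrC.
  by rewrite [br g (U x) _](br_sym char2).
have V_form x y z : B (V x y) z =
    B x (br g (U y) (U z)) + B z (br g (U x) (U y)) + B y (br g (U z) (U x)).
  rewrite /V (tilde_brE B_NIS) UD !linearDl /= -/U !U_sym.
  rewrite [B (br g (U x) _) z](NIS_symmetric B_NIS) !(NIS_invariant B_NIS).
  by rewrite [br g (U z) _](br_sym char2) -[LHS]addrA [LHS]addrC.
split.
- by split=> _; [apply: U_sym | apply: R_sym].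
- split=> [YB x y | homU f h l].
    apply/(addv_eq0_pchar2 char2)/(NIS_nondegenerate B_NIS) => z.
    by rewrite V_form -!PhiE; apply: YB.
  rewrite -[f](PhiVK B_NIS) -[h](PhiVK B_NIS) -[l](PhiVK B_NIS) !PhiE.
  rewrite -V_form /V homU (addvv_pchar2 char2).
  exact: linear0l.
- (* The obstruction to [U] respecting the squarings on odd vectors. *)
  pose W x := U (tilde_sq B R x) + sq g (U x).
  have key x z :
    ((Phi B z \o ad (sq g (R (Phi B x))))
      + (Phi B x \o ad (br g (R (Phi B z)) (R (Phi B x))))
      + (Phi B x \o ad (R (Phi B z \o ad (R (Phi B x)))
                        + R (Phi B x \o ad (R (Phi B z)))))
      + (Phi B z \o ad (R (Phi B x \o ad (R (Phi B x))))))%VF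
    = Phi B (ad z (W x) + ad x (V x z)).
    rewrite !(Phi_comp_ad B_NIS) -!linearD !adE; congr (Phi B _).
    rewrite V_sym /W /V (tilde_sqE B_NIS) (tilde_brE B_NIS) UD /U /Umap.
    rewrite !linearDr /= [LHS]addrC -!addrA; do 2!congr (_ + _).
    by rewrite [LHS]addrC -addrA addrCA addrA.
  split=> [cond x z x_od | cond h f].
    apply/(addv_eq0_pchar2 char2); rewrite -[LHS](PhiK B_NIS) -key.
    by rewrite cond ?linear0 // (dual_odd_Phi B_NIS).
  rewrite -[f](PhiVK B_NIS) -[h](PhiVK B_NIS) (dual_odd_Phi B_NIS) => x_od.
  rewrite key; set x := (_ f) in x_od *; set z := (_ h).
  by rewrite [ad z _]cond // (addvv_pchar2 char2) linear0.
Qed.
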